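(* For every graph $G$, $r(G)\le \left\lfloor \frac{\Delta(G)}{2}\right\rfloor r_v(G)$ and $r(G)\le \left\lfloor \frac{\Delta(G)}{2}\right\rfloor r'_v(G)$; that is, $\frac{r(G)}{r_v(G)}\le \left\lfloor \frac{\Delta(G)}{2}\right\rfloor$ and $\frac{r(G)}{r'_v(G)}\le \left\lfloor \frac{\Delta(G)}{2}\right\rfloor$. Furthermore, these bounds are best possible: for every integer $\Delta\ge 2$ there is a graph $G$ with $\Delta(G)=\Delta$ and $\frac{r(G)}{r_v(G)}=\frac{r(G)}{r'_v(G)}=\left\lfloor \frac{\Delta}{2}\right\rfloor$.
   Context: Graphs are finite, connected, may have multiple edges but no loops. The resistance $r(G)$ is the minimum number of edges that have to be removed from $G$ to obtain a $\Delta(G)$-edge-colorable subgraph. A graph $H$ is class 1 if $\chi'(H)=\Delta(H)$, where $\chi'$ is the chromatic index. $r_v(G)$ is the minimum number of vertices that have to be removed from $G$ to obtain a class 1 graph, and $r'_v(G)$ is the minimum number of vertices that have to be removed from $G$ to obtain a graph $K$ with $\chi'(K)\le \Delta(G)$. *)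

(* Defs.v *)
From mathcomp Require Import all_boot all_order all_algebra.

Set Implicit Arguments.
Unset Strict Implicit.
Unset Printing Implicit Defensive.

(* Edges form a type of their own, so parallel edges are allowed; two distinct
   ends exclude loops. Connectedness is a separate predicate because deleting
   edges or vertices need not preserve it. *)
Record mgraph := MGraph {
  vertex : finType;
  edge : finType;
  ends : edge -> {set vertex};
  card_ends : forall e, #|ends e| = 2
}.

Definition adjacent (G : mgraph) : rel (vertex G) :=
  fun x y => [exists e, ends e == [set x; y]].

Definition connected (G : mgraph) : Prop :=
  0 < #|vertex G| /\ forall x y : vertex G, connect (@adjacent G) x y.

Definition degree (G : mgraph) (x : vertex G) : nat :=
  #|[set e : edge G | x \in ends e]|.

Definition max_degree (G : mgraph) : nat := \max_(x : vertex G) degree x.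

Definition proper_coloring (G : mgraph) (k : nat) (c : {ffun edge G -> 'I_k}) :
    bool :=
  [forall e, forall f,
     (e != f) && ~~ [disjoint ends e & ends f] ==> (c e != c f)].

Definition edge_colorable (G : mgraph) (k : nat) : bool :=
  [exists c : {ffun edge G -> 'I_k}, proper_coloring c].

Lemma edge_colorable_card (G : mgraph) : edge_colorable G #|edge G|.
Proof.
apply/existsP; exists [ffun e => enum_rank e].
apply/forallP=> e; apply/forallP=> f; apply/implyP=> /andP[ef _].
by rewrite !ffunE (inj_eq enum_rank_inj).
Qed.

Lemma ex_edge_colorable (G : mgraph) : exists k, edge_colorable G k.
Proof. by exists #|edge G|; apply: edge_colorable_card. Qed.

Definition chromatic_index (G : mgraph) : nat := ex_minn (ex_edge_colorable G).

Definition class1 (G : mgraph) : bool := chromatic_index G == max_degree G.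

Definition del_edges (G : mgraph) (F : {set edge G}) : mgraph :=
  @MGraph (vertex G) {e : edge G | e \notin F}
    (fun e => ends (val e)) (fun e => card_ends (val e)).

Definition del_vertices_ends (G : mgraph) (S : {set vertex G})
    (e : {e : edge G | [disjoint ends e & S]}) :
    {set {x : vertex G | x \notin S}} :=
  [set x | val x \in ends (val e)].

Lemma card_del_vertices_ends (G : mgraph) (S : {set vertex G})
    (e : {e : edge G | [disjoint ends e & S]}) :
  #|del_vertices_ends e| = 2.
Proof.
rewrite -(card_ends (val e)) -(card_imset _ val_inj); congr #|pred_of_set _|.
apply/setP=> x; apply/imsetP/idP=> [[y]|xe]; first by rewrite inE => ye ->.
have xS : x \notin S by rewrite (disjointFr (valP e) xe).
by exists (Sub x xS); rewrite ?inE ?SubK.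
Qed.

Definition del_vertices (G : mgraph) (S : {set vertex G}) : mgraph :=
  @MGraph {x : vertex G | x \notin S} {e : edge G | [disjoint ends e & S]}
    (@del_vertices_ends G S) (@card_del_vertices_ends G S).

Lemma edgeless_colorable (G : mgraph) k : #|edge G| = 0 -> edge_colorable G k.
Proof.
move=> E0; apply/existsP.
have none (e : edge G) : False by have := fintype0 e E0.
exists [ffun e => False_rect _ (none e)].
by apply/forallP=> e; case: (none e).
Qed.

Lemma edgeless_chromatic_index (G : mgraph) :
  #|edge G| = 0 -> chromatic_index G = 0.
Proof.
move=> E0; rewrite /chromatic_index; case: ex_minnP => k _ /(_ 0).
by rewrite edgeless_colorable // leqn0 => /(_ isT) /eqP.
Qed.

Lemma edgeless_class1 (G : mgraph) : #|edge G| = 0 -> class1 G.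
Proof.
move=> E0; rewrite /class1 edgeless_chromatic_index // eq_sym -leqn0.
by apply/bigmax_leqP=> x _; rewrite -E0 max_card.
Qed.

Lemma del_edgesT_edgeless (G : mgraph) :
  #|edge (del_edges [set: edge G])| = 0.
Proof. by apply: eq_card0 => -[e He]; exfalso; rewrite inE in He. Qed.

Lemma del_verticesT_edgeless (G : mgraph) :
  #|edge (del_vertices [set: vertex G])| = 0.
Proof.
apply: eq_card0 => -[e He]; exfalso.
have: 0 < #|ends e| by rewrite card_ends.
by case/card_gt0P=> x xe; have := disjointFr He xe; rewrite inE.
Qed.

Definition resistance_pred (G : mgraph) (n : nat) : bool :=
  [exists F : {set edge G},
     (#|F| == n) && edge_colorable (del_edges F) (max_degree G)].

Definition vresistance_pred (G : mgraph) (n : nat) : bool :=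
  [exists S : {set vertex G}, (#|S| == n) && class1 (del_vertices S)].

Definition vresistance'_pred (G : mgraph) (n : nat) : bool :=
  [exists S : {set vertex G},
     (#|S| == n) && (chromatic_index (del_vertices S) <= max_degree G)].

Lemma ex_resistance (G : mgraph) : exists n, resistance_pred G n.
Proof.
exists #|[set: edge G]|; apply/existsP; exists [set: edge G].
by rewrite eqxx edgeless_colorable // del_edgesT_edgeless.
Qed.

Lemma ex_vresistance (G : mgraph) : exists n, vresistance_pred G n.
Proof.
exists #|[set: vertex G]|; apply/existsP; exists [set: vertex G].
by rewrite eqxx edgeless_class1 // del_verticesT_edgeless.
Qed.

Lemma ex_vresistance' (G : mgraph) : exists n, vresistance'_pred G n.
Proof.
exists #|[set: vertex G]|; apply/existsP; exists [set: vertex G].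
by rewrite eqxx edgeless_chromatic_index // del_verticesT_edgeless.
Qed.

(* The parameters r, r_v and r'_v. *)
Definition resistance (G : mgraph) : nat := ex_minn (ex_resistance G).
Definition vresistance (G : mgraph) : nat := ex_minn (ex_vresistance G).
Definition vresistance' (G : mgraph) : nat := ex_minn (ex_vresistance' G).

Definition qratio (m n : nat) : rat := (m%:R / n%:R)%R.

(* Main.v *)
(** Let [k = Delta(G)] and let [G - S] be [k]-edge-colourable.  Among the partial
    proper [k]-colourings of [G] whose uncoloured edges all meet [S], take one
    with as few uncoloured edges as possible.  Let [v] be a vertex and let [w],
    [w'] be further ends of uncoloured edges at [v].  By minimality no colour is
    missing at both [v] and [w].  If a colour [b] were missing at [w] and at
    [w'] <> [w], and [a] at [v], then one of [w], [w'] would not lie on the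
    [a]/[b]-chain of [v], and a Kempe swap there would allow one more edge to be
    coloured.  So the sets of colours missing at the ends [w] are disjoint and
    consist of colours present at [v]; as each [w] misses at least as many
    colours as it has uncoloured edges, at most half of the edges at [v] are
    uncoloured.  Summing over [S] gives [r <= (k / 2) * r'_v <= (k / 2) * r_v].

    The bound is attained by the triangle with edge multiplicities [t], [t] and
    [D - t], where [t = D / 2]: its [D + t] edges pairwise intersect, so [t] of
    them must go, whereas deleting one vertex leaves a bundle of parallel edges. *)

Require Import Defs.
From mathcomp Require Import all_boot all_order all_algebra.
From mathcomp Require Import perm zify.

Set Implicit Arguments.
Unset Strict Implicit.
Unset Printing Implicit Defensive.

(** * Orbits of a product of two involutions *)

Section TwoInvolutions.

Variables (T : finType) (A B : T -> T).
Hypotheses (AK : involutive A) (BK : involutive B).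

Let s := A \o B.
Let s' := B \o A.

Let sK : cancel s s'. Proof. by move=> x; rewrite /s /s' /= AK BK. Qed.
Let s'K : cancel s' s. Proof. by move=> x; rewrite /s /s' /= BK AK. Qed.

Let iter_sK n : cancel (iter n s) (iter n s').
Proof. by elim: n => // n IH x; rewrite iterSr iterS sK IH. Qed.

Let iter_s'K n : cancel (iter n s') (iter n s).
Proof. by elim: n => // n IH x; rewrite iterSr iterS s'K IH. Qed.

Let B_iter n x : B (iter n s x) = iter n s' (B x).
Proof. by elim: n => // n IH; rewrite !iterS -IH. Qed.

(** [B] conjugates [s] to its inverse [s'], and [A v = v] gives [B v = s' v]. A [B]-fixed point
    [s^n v] therefore equals [s'^(n+1) v]. *)
Let iter_odd_fixed v n :
  A v = v -> B (iter n s v) = iter n s v -> iter n.*2.+1 s v = v.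
Proof.
move=> Av; rewrite B_iter -{1}Av -[B (A v)]/(s' v) -iterSr => Bn.
by rewrite -addnn -addSn iterD -Bn iter_s'K.
Qed.

(* If [s^(2i+1)] and [s^(2j+1)] fix [v] then [v] has an
   odd period dividing [2(j - i)], hence dividing [j - i]. *)
Lemma involutions_fixed_unique v w1 w2 : A v = v -> B w1 = w1 -> B w2 = w2 ->
  fconnect s v w1 -> fconnect s v w2 -> w1 = w2.
Proof.
move=> Av + + c1 c2; rewrite -(iter_findex c1) -(iter_findex c2).
move: (findex s v w1) (findex s v w2) => i j {c1 c2}.
wlog le_ij : i j / i <= j => [hw Bi Bj|].
  by case/orP: (leq_total i j) => le; [|symmetry]; apply: hw.
move=> Bi Bj; have fi := iter_odd_fixed Av Bi; have fj := iter_odd_fixed Av Bj.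
have f2 : iter (j - i).*2 s v = v.
  apply: (can_inj (iter_sK i.*2.+1)).
  by rewrite -iterD fi -[RHS]fj; congr (iter _ s v); lia.
have fd : iter (j - i) s v = v.
  rewrite -{2}(iter_fix (j - i) fi) -iterM.
  have -> : (j - i) * i.*2.+1 = (j - i) + i * (j - i).*2 by lia.
  by rewrite iterD iterM (iter_fix i f2).
by rewrite -[in RHS](subnKC le_ij) iterD fd.
Qed.

Lemma fconnect_involutions_sym x y : fconnect s x y = fconnect s y x.
Proof. by apply: fconnect_sym; apply: can_inj sK. Qed.

(** As [w] is fixed by [B], [B] sends [s^n w] to [s'^n w], in the same orbit; and [A x = s (B x)].
    Hence the [s]-orbit of an end of a Kempe chain is the whole chain. *)
Lemma fconnect_involutions_closed w x : B w = w -> fconnect s w x ->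
  fconnect s w (A x) /\ fconnect s w (B x).
Proof.
move=> Bw wx.
have cB : fconnect s w (B x).
  move/esym: (iter_findex wx); move: (findex s w x) => n ->.
  rewrite B_iter Bw fconnect_involutions_sym.
  by rewrite -[X in fconnect _ _ X](iter_s'K n) fconnect_iter.
split=> //; rewrite -[x]BK.
exact: connect_trans cB (fconnect1 _ _).
Qed.

End TwoInvolutions.

(** * Partial edge colourings and missing colours *)

Section PartialColorings.

Variables (G : mgraph) (k : nat).
Implicit Types (c : {ffun edge G -> option 'I_k}) (e f : edge G).
Implicit Types (x y v w : vertex G) (a b : 'I_k) (X : {set vertex G}).

Definition partial_proper c : bool :=
  [forall e, forall f, [forall x, [forall a,
     [&& x \in ends e, x \in ends f, c e == Some a & c f == Some a]
       ==> (e == f)]]].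

Lemma partial_properP c :
  reflect (forall e f x a, x \in ends e -> x \in ends f ->
             c e = Some a -> c f = Some a -> e = f)
          (partial_proper c).
Proof.
apply: (iffP forallP) => [h e f x a xe xf ce cf|h e].
  move/forallP/(_ f)/forallP/(_ x)/forallP/(_ a): (h e).
  by rewrite xe xf ce cf !eqxx => /eqP.
apply/forallP=> f; apply/forallP=> x; apply/forallP=> a.
by apply/implyP=> /and4P[xe xf /eqP ce /eqP cf]; apply/eqP; apply: (h e f x a).
Qed.

Definition uncolored c : {set edge G} := [set e | c e == None].

Definition missing c x : {set 'I_k} :=
  [set a | [forall e, (x \in ends e) ==> (c e != Some a)]].

Lemma missingP c x a :
  reflect (forall e, x \in ends e -> c e <> Some a) (a \in missing c x).
Proof.
rewrite inE; apply: (iffP forallP) => h e.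
  by move=> xe; apply/eqP/(implyP (h e)).
by apply/implyP=> xe; apply/eqP/h.
Qed.

Lemma notin_missing c x a : a \notin missing c x ->
  exists2 e, x \in ends e & c e = Some a.
Proof.
rewrite inE negb_forall => /existsP[e]; rewrite negb_imply negbK.
by case/andP=> xe /eqP ce; exists e.
Qed.

(** Properness makes [c] injective on the coloured edges at [x], and the colours it takes there are
    exactly those not missing. *)
Lemma card_missing_colored c x : partial_proper c ->
  #|missing c x| + #|[set e | x \in ends e] :\: uncolored c| = k.
Proof.
move/partial_properP=> cP.
rewrite -[RHS]card_ord -(cardsC (missing c x)); congr addn.
rewrite -(card_in_imset (f := c)); last first.
  move=> e f; rewrite !inE => /andP[ne xe] /andP[_ xf] eq_c.
  case ce: (c e) ne => [a|//] _; apply: (cP _ _ x a) => //.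
  by rewrite -eq_c.
rewrite -(card_imset (~: _) (@Some_inj _)); congr #|pred_of_set _|.
apply/setP=> o; apply/imsetP/imsetP=> [[e]|[a]].
  rewrite !inE => /andP[ne xe] ->; case ce: (c e) ne => [a|//] _.
  exists a => //; rewrite in_setC; apply/negP=> /missingP/(_ e xe); exact.
rewrite in_setC => /notin_missing[e xe ce] ->.
by exists e; rewrite // !inE ce.
Qed.

Lemma card_uncolored_missing c x : partial_proper c -> degree x <= k ->
  #|[set e | x \in ends e] :&: uncolored c| <= #|missing c x|.
Proof.
move=> /(card_missing_colored x) card_c.
by rewrite /degree -(cardsID (uncolored c)); lia.
Qed.

Lemma ends_set2 e x y : x \in ends e -> y \in ends e -> x != y ->
  ends e = [set x; y].
Proof.
move=> xe ye xy; apply/esym/eqP; rewrite eqEcard cards2 xy card_ends leqnn.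
by rewrite andbT; apply/subsetP=> z; rewrite !inE => /orP[]/eqP->.
Qed.

Lemma other_end e x : x \in ends e -> exists2 y, y != x & ends e = [set x; y].
Proof.
move=> xe; have: 0 < #|ends e :\ x|.
  by have := card_ends e; rewrite (cardsD1 x) xe; lia.
case/card_gt0P=> y; rewrite !inE => /andP[yx ye]; exists y => //.
by apply: ends_set2; rewrite // eq_sym.
Qed.

(* [partner c a] is the involution that swaps the ends of every edge coloured
   [a] and fixes the vertices at which [a] is missing. *)
Definition partner c a x : vertex G :=
  odflt x [pick y | [exists e, (c e == Some a) && (ends e == [set x; y])]].

Lemma partner_missing c a x : a \in missing c x -> partner c a x = x.
Proof.
move/missingP=> ax; rewrite /partner; case: pickP => // y.
case/existsP=> e /andP[/eqP ce /eqP xy].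
by case: (ax e) => //; rewrite xy set21.
Qed.

Lemma partner_edge c a x e : partial_proper c -> x \in ends e ->
  c e = Some a -> ends e = [set x; partner c a x].
Proof.
move=> /partial_properP cP xe ce; rewrite /partner; case: pickP => [y|none].
  case/existsP=> f /andP[/eqP cf /eqP xy].
  by rewrite (cP e f x a) // xy set21.
have [y _ xy] := other_end xe.
by have /existsP[] := none y; exists e; rewrite ce xy !eqxx.
Qed.

Lemma partnerK c a : partial_proper c -> involutive (partner c a).
Proof.
move=> cP x; case: (boolP (a \in missing c x)) => [ax|/notin_missing[e xe ce]].
  by rewrite !partner_missing.
have E := partner_edge cP xe ce.
have pe : partner c a x \in ends e by rewrite E set22.
have E' := partner_edge cP pe ce.
have := card_ends e; rewrite {1}E cards2; case: eqVneq => // ne _.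
have := xe; rewrite E' !inE => /orP[] /eqP // e1.
by rewrite -e1 eqxx in ne.
Qed.

(** * Kempe swaps *)

Definition kempe_swap c a b X : {ffun edge G -> option 'I_k} :=
  [ffun e => if [disjoint ends e & X] then c e else omap (tperm a b) (c e)].

Lemma uncolored_kempe_swap c a b X :
  uncolored (kempe_swap c a b X) = uncolored c.
Proof. by apply/setP=> e; rewrite !inE ffunE; case: ifP; case: (c e). Qed.

Definition partner_closed c a X := forall x, x \in X -> partner c a x \in X.

(** The ends of [e] are exchanged by the involution [partner c a], so a closed [X] contains both or
    neither. Thus no edge leaving [X] has a swapped colour. *)
Lemma partner_closed_edge c a X x e : partial_proper c ->
  partner_closed c a X -> c e = Some a -> x \in ends e ->
  ~~ [disjoint ends e & X] -> x \in X.
Proof.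
move=> cP clX ce xe /pred0Pn[y /=/andP[]].
rewrite (partner_edge cP xe ce) !inE => /orP[]/eqP-> //.
by move/clX; rewrite partnerK.
Qed.

Lemma kempe_swap_proper c a b X : partial_proper c ->
  partner_closed c a X -> partner_closed c b X ->
  partial_proper (kempe_swap c a b X).
Proof.
move=> cP cla clb; have /partial_properP cP' := cP.
(* If only [f] meets [X], the common end lies outside [X], so the colour of [f] is neither [a] nor
   [b] and the swap leaves it unchanged. *)
have mixed e f x g : x \in ends e -> x \in ends f ->
    [disjoint ends e & X] -> ~~ [disjoint ends f & X] ->
    c e = Some g -> omap (tperm a b) (c f) = Some g -> e = f.
  move=> xe xf dX mX ce; case cf: (c f) => [h|//] /= [tg].
  have xX : x \notin X by rewrite (disjointFr dX xe).
  have ha : a != h.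
    apply: contra xX => /eqP ah; rewrite -ah in cf.
    exact: partner_closed_edge cP cla cf xf mX.
  have hb : b != h.
    apply: contra xX => /eqP bh; rewrite -bh in cf.
    exact: partner_closed_edge cP clb cf xf mX.
  by apply: (cP' e f x g) => //; rewrite cf -tg tpermD.
apply/partial_properP=> e f x g xe xf; rewrite !ffunE.
case: ifPn => de; case: ifPn => df.
- exact: cP' xe xf.
- by move=> ce cf; apply: (mixed _ _ x g).
- by move=> ce cf; apply/esym; apply: (mixed _ _ x g).
- case ce: (c e) => [h|//] /= [<-]; case cf: (c f) => [h'|//] /= [/perm_inj E].
  by apply: (cP' e f x h); rewrite // cf E.
Qed.

Lemma missing_kempe_swap_out c a b X x g : x \notin X ->
  partial_proper c -> partner_closed c a X -> partner_closed c b X ->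
  g \in missing c x -> g \in missing (kempe_swap c a b X) x.
Proof.
move=> xX cP cla clb /missingP gx; apply/missingP=> e xe; rewrite ffunE.
case: ifPn => [_|mX]; first exact: gx.
case ce: (c e) => [h|//] /= [tg].
have ha : a != h.
  apply: contra xX => /eqP ah; rewrite -ah in ce.
  exact: partner_closed_edge cP cla ce xe mX.
have hb : b != h.
  apply: contra xX => /eqP bh; rewrite -bh in ce.
  exact: partner_closed_edge cP clb ce xe mX.
by apply: (gx e xe); rewrite ce -tg tpermD.
Qed.

Lemma missing_kempe_swap_in c a b X x : x \in X ->
  b \in missing c x -> a \in missing (kempe_swap c a b X) x.
Proof.
move=> xX /missingP bx; apply/missingP=> e xe; rewrite ffunE.
have -> : [disjoint ends e & X] = false.
  by apply/negbTE/pred0Pn; exists x; rewrite /= xe.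
case ce: (c e) => [h|//] /= [th]; apply: (bx e xe); rewrite ce; congr Some.
by apply: (@perm_inj _ (tperm a b)); rewrite tpermR.
Qed.

(** * Colourings that cannot be augmented *)

Lemma extend_coloring c e v w a : partial_proper c -> ends e = [set v; w] ->
  c e = None -> a \in missing c v -> a \in missing c w ->
  exists2 c', partial_proper c' & uncolored c' = uncolored c :\ e.
Proof.
move=> /partial_properP cP vw ce /missingP av /missingP aw.
have new f x : x \in ends e -> x \in ends f -> c f <> Some a.
  by rewrite vw !inE => /orP[]/eqP->; [exact: (av f)|exact: (aw f)].
exists [ffun f => if f == e then Some a else c f]; last first.
  by apply/setP=> f; rewrite !inE ffunE; case: (f =P e).
apply/partial_properP=> f g x h xf xg; rewrite !ffunE.
case: eqP => [fe|_]; case: eqP => [ge|_].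
- by rewrite fe ge.
- by case=> <- cg; case: (new g x); rewrite -?fe.
- by move=> cf [ha]; case: (new f x); rewrite -?ge // cf ha.
- exact: cP xf xg.
Qed.

(** A local form of minimality. Only the uncoloured sets are compared, so [c'] may recolour other
    edges, as it does after a Kempe swap. *)
Definition unaugmentable c := forall c' e, partial_proper c' ->
  c e = None -> uncolored c' <> uncolored c :\ e.

Lemma unaugmentable_disjoint c e v w b : partial_proper c -> unaugmentable c ->
  ends e = [set v; w] -> c e = None -> b \in missing c w -> b \notin missing c v.
Proof.
move=> cP cM vw ce bw; apply/negP=> bv.
by have [c' c'P] := extend_coloring cP vw ce bv bw; apply: cM.
Qed.

(* Otherwise swapping the two colours along the chain of [w] frees a colour
   common to both ends of [e]. *)
Lemma unaugmentable_chain c e v w a b : partial_proper c -> unaugmentable c ->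
  ends e = [set v; w] -> c e = None -> a \in missing c v ->
  b \in missing c w -> fconnect (partner c a \o partner c b) v w.
Proof.
move=> cP cM vw ce av bw; apply/negPn/negP=> nvw.
have aK := partnerK a cP; have bK := partnerK b cP.
pose X := [set x | fconnect (partner c a \o partner c b) w x].
have bfix := partner_missing bw.
have clX x : x \in X -> (partner c a x \in X) /\ (partner c b x \in X).
  by rewrite !inE; apply: fconnect_involutions_closed.
have cla : partner_closed c a X by move=> x /clX[].
have clb : partner_closed c b X by move=> x /clX[].
have vX : v \notin X by rewrite inE fconnect_involutions_sym.
have wX : w \in X by rewrite inE connect0.
have := extend_coloring (kempe_swap_proper cP cla clb) vw.
case/(_ a).
- by rewrite ffunE ce /=; case: ifP.
- exact: missing_kempe_swap_out.
- exact: missing_kempe_swap_in.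
- by move=> c' c'P; rewrite uncolored_kempe_swap; apply: cM.
Qed.

(** Pairs [(w, b)] are counted twice, with [w] in [W] and [b] missing at [w]: each [w] lies in at
    least as many pairs as it has uncoloured edges to [v], each [b] in at most one pair, and in none
    if it is missing at [v]. *)
Lemma unaugmentable_uncolored c v : partial_proper c -> unaugmentable c ->
  (forall x, degree x <= k) ->
  #|[set e | v \in ends e] :&: uncolored c| <= k %/ 2.
Proof.
move=> cP cM deg_k; set U := _ :&: _.
(* The default [v] is never returned for an edge of [U]. *)
pose other e := odflt v [pick y in ends e :\ v].
have otherE e : e \in U -> ends e = [set v; other e] /\ c e = None.
  rewrite !inE => /andP[ve /eqP->]; split=> //; rewrite /other.
  case: pickP => [y|none]; first by rewrite !inE => /andP[yv ye];
    apply: ends_set2; rewrite // eq_sym.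
  have [y yv vy] := other_end ve.
  by have := none y; rewrite !inE yv vy set22.
pose W := other @: U.
have WP w : w \in W -> exists e, ends e = [set v; w] /\ c e = None.
  by case/imsetP=> e /otherE eU ->; exists e.
(* Since [degree v <= k], also [#|U| <= #|missing c v|]; the two bounds add up to [2 #|U| <= k]. *)
suff le_U : #|U| <= #|~: missing c v|.
  have := cardsC (missing c v); rewrite card_ord => card_v.
  have := card_missing_colored v cP; have := deg_k v.
  by rewrite /degree -(cardsID (uncolored c)) -/U; lia.
have [->|[e0 e0U]] := set_0Vmem U; first by rewrite cards0.
(* One colour [a] serves for all chains starting at [v]; it exists because [U] is nonempty. *)
have [a av] : exists a, a \in missing c v.
  apply/card_gt0P; apply: leq_trans (card_uncolored_missing cP (deg_k v)).
  by apply/card_gt0P; exists e0.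
have -> : #|U| = \sum_(w in W) #|[set e in U | other e == w]|.
  rewrite -sum1_card (partition_big other (mem W)) /=; last first.
    by move=> e eU; apply: imset_f.
  by apply: eq_bigr => w _; rewrite -sum1_card; apply: eq_bigl => e; rewrite !inE.
have le_w w : w \in W ->
    #|[set e in U | other e == w]| <= \sum_b (b \in missing c w).
  move=> _; rewrite -big_mkcond /= sum1_card.
  apply: leq_trans (card_uncolored_missing cP (deg_k w)); apply: subset_leq_card.
  apply/subsetP=> e; rewrite inE => /andP[eU /eqP <-].
  have [E ce] := otherE e eU.
  by rewrite !inE E set22 ce.
apply: (leq_trans (@leq_sum _ _ _ _ _ le_w)).
rewrite exchange_big -sum1_card [X in _ <= X]big_mkcond /=.
apply: leq_sum => b _; rewrite -big_mkcondr /= sum1dep_card.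
case: ifPn => [_|]; last first.
  rewrite inE negbK => bv; rewrite leqn0 cards_eq0 -subset0.
  apply/subsetP=> w; rewrite inE => /andP[/WP[e [vw ce]] bw].
  by have := unaugmentable_disjoint cP cM vw ce bw; rewrite bv.
(* Both [w1] and [w2] are ends, other than [v], of the [a]/[b]-chain that starts at [v]. *)
apply/card_le1_eqP => w2 w1.
rewrite inE => /andP[/WP[e2 [vw2 ce2]] bw2].
rewrite inE => /andP[/WP[e1 [vw1 ce1]] bw1].
apply: (involutions_fixed_unique (partnerK a cP) (partnerK b cP) (v := v)).
- exact: partner_missing av.
- exact: partner_missing bw1.
- exact: partner_missing bw2.
- exact: unaugmentable_chain vw1 ce1 av bw1.
- exact: unaugmentable_chain vw2 ce2 av bw2.
Qed.

(** The number of uncoloured edges is minimized among colourings whose uncoloured set lies in that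
    of [c0]; removing an edge from this set stays within the family. *)
Lemma ex_unaugmentable c0 : partial_proper c0 ->
  exists c, [/\ partial_proper c, unaugmentable c
              & uncolored c \subset uncolored c0].
Proof.
move=> c0P.
pose P c := partial_proper c && (uncolored c \subset uncolored c0).
have Pc0 : P c0 by rewrite /P c0P subxx.
case: (@arg_minnP _ c0 P (fun c => #|uncolored c|) Pc0) => c /andP[cP sub] cmin.
exists c; split=> // c' e c'P ce U'.
have eU : e \in uncolored c by rewrite inE ce.
have := cmin c'; rewrite /P c'P U' (subset_trans (subD1set _ _) sub) => /(_ isT).
by rewrite (cardsD1 e (uncolored c)) eU; lia.
Qed.

Lemma del_uncolored_colorable c : partial_proper c ->
  edge_colorable (del_edges (uncolored c)) k.
Proof.
move/partial_properP=> cP.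
have col (e : edge (del_edges (uncolored c))) : exists a, c (val e) == Some a.
  have := valP e; rewrite /= inE.
  by case: (c _) => [a|//] _; exists a.
apply/existsP; exists [ffun e => xchoose (col e)].
apply/forallP=> e; apply/forallP=> f; apply/implyP=> /andP[ef].
case/pred0Pn=> x /=/andP[xe xf]; rewrite !ffunE; apply: contra ef => /eqP E.
apply/eqP/val_inj; apply: (cP _ _ x (xchoose (col e)) xe xf).
  exact/eqP/(xchooseP (col e)).
by rewrite E; apply/eqP/(xchooseP (col f)).
Qed.

Lemma del_vertices_partial (S : {set vertex G}) :
  edge_colorable (del_vertices S) k ->
  exists2 c, partial_proper c
    & forall e, e \in uncolored c -> ~~ [disjoint ends e & S].
Proof.
case/existsP=> d /forallP dP.
(* [insub] yields [None] exactly on the edges that meet [S]. *)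
exists [ffun e => omap d (insub e)]; last first.
  by move=> e; rewrite inE ffunE; case: insubP.
apply/partial_properP=> e f x a xe xf; rewrite !ffunE.
case: insubP => [e' eS ee|//] /= [da]; case: insubP => [f' fS ff|//] /= [db].
have xS : x \notin S by rewrite (disjointFr eS xe).
rewrite -ee -ff; congr val; apply/eqP.
have /forallP/(_ f') := dP e'; rewrite da db eqxx implybF negb_and !negbK.
case/orP=> // /disjointFr/(_ (_ : Sub x xS \in _)).
by rewrite !inE /= ee ff xe xf => /(_ isT).
Qed.

End PartialColorings.

(** * Chromatic index and the upper bounds on the resistance *)

Lemma edge_colorable_mono (G : mgraph) j k : j <= k ->
  edge_colorable G j -> edge_colorable G k.
Proof.
move=> jk /existsP[c /forallP cP]; apply/existsP.
exists [ffun e => widen_ord jk (c e)].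
apply/forallP=> e; apply/forallP=> f; apply/implyP=> ef; rewrite !ffunE.
by move/forallP/(_ f)/implyP/(_ ef): (cP e).
Qed.

Lemma chromatic_index_le (G : mgraph) k :
  (chromatic_index G <= k) = edge_colorable G k.
Proof.
rewrite /chromatic_index; case: ex_minnP => j cj jmin; apply/idP/idP; last exact: jmin.
by move=> jk; apply: edge_colorable_mono cj.
Qed.

Lemma degree_le_max (G : mgraph) (x : vertex G) : degree x <= max_degree G.
Proof. exact: (leq_bigmax_cond (F := @degree G)). Qed.

(** Used for the edges at a vertex and for all surviving edges of the fat triangle. *)
Lemma edge_colorable_intersecting (G : mgraph) k (E : {set edge G}) :
  {in E &, forall e f, ~~ [disjoint ends e & ends f]} ->
  edge_colorable G k -> #|E| <= k.
Proof.
move=> EI /existsP[c /forallP cP]; rewrite -[k]card_ord.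
rewrite -(card_in_imset (f := c)) ?max_card // => e f eE fE cef.
have /forallP/(_ f) := cP e; rewrite cef eqxx implybF EI // andbT negbK.
by move/eqP.
Qed.

Lemma max_degree_chromatic_index (G : mgraph) :
  max_degree G <= chromatic_index G.
Proof.
apply/bigmax_leqP=> x _; apply: edge_colorable_intersecting; last first.
  by rewrite -chromatic_index_le.
by move=> e f; rewrite !inE => xe xf; apply/pred0Pn; exists x; rewrite /= xe.
Qed.

Lemma common_end_class1 (G : mgraph) (x : vertex G) :
  (forall e : edge G, x \in ends e) -> class1 G.
Proof.
move=> xE; rewrite /class1 eqn_leq max_degree_chromatic_index andbT.
apply: leq_trans (degree_le_max x).
rewrite /degree; have -> : [set e : edge G | x \in ends e] = [set: edge G].
  by apply/setP=> e; rewrite !inE xE.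
by rewrite cardsT chromatic_index_le edge_colorable_card.
Qed.

Lemma max_degree_del_vertices (G : mgraph) (S : {set vertex G}) :
  max_degree (del_vertices S) <= max_degree G.
Proof.
apply/bigmax_leqP=> x _; apply: leq_trans (degree_le_max (val x)).
rewrite /degree -(card_imset _ val_inj); apply: subset_leq_card.
by apply/subsetP=> e /imsetP[e']; rewrite !inE => xe ->.
Qed.

Lemma resistance_le (G : mgraph) (F : {set edge G}) :
  edge_colorable (del_edges F) (max_degree G) -> resistance G <= #|F|.
Proof.
move=> cF; rewrite /resistance; case: ex_minnP => n _; apply.
by apply/existsP; exists F; rewrite eqxx.
Qed.

Lemma vresistance_le (G : mgraph) (S : {set vertex G}) :
  class1 (del_vertices S) -> vresistance G <= #|S|.
Proof.
move=> cS; rewrite /vresistance; case: ex_minnP => n _; apply.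
by apply/existsP; exists S; rewrite eqxx.
Qed.

(** A class 1 graph [del_vertices S] has chromatic index equal to its own maximum degree, which is
    at most that of [G]. *)
Lemma vresistance'_le_vresistance (G : mgraph) :
  vresistance' G <= vresistance G.
Proof.
rewrite /vresistance; case: ex_minnP => n /existsP[S /andP[/eqP cS /eqP S1]] _.
rewrite /vresistance'; case: ex_minnP => m _; apply.
by apply/existsP; exists S; rewrite cS eqxx S1 max_degree_del_vertices.
Qed.

Lemma resistance_le_vresistance' (G : mgraph) :
  resistance G <= (max_degree G %/ 2) * vresistance' G.
Proof.
rewrite /vresistance'; case: ex_minnP => n /existsP[S /andP[/eqP <-]] + _.
rewrite chromatic_index_le => /del_vertices_partial[c0 c0P c0S].
have [c [cP cM /subsetP cU]] := ex_unaugmentable c0P.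
apply: leq_trans (resistance_le (del_uncolored_colorable cP)) _.
pose Ux x := [set e | x \in ends e] :&: uncolored c.
(* Each uncoloured edge of [c] is uncoloured in [c0], hence meets [S] and is counted at least
   once. *)
apply: (@leq_trans (\sum_(x in S) #|Ux x|)).
  rewrite -sum1_card.
  under [leqRHS]eq_bigr do rewrite -sum1_card.
  rewrite (exchange_big_dep (mem (uncolored c))) /=; last first.
    by move=> x e _; rewrite !inE => /andP[].
  apply: leq_sum => e eU; rewrite sum1dep_card; apply/card_gt0P.
  have /pred0Pn[x /=/andP[xe xS]] := c0S e (cU e eU).
  by exists x; rewrite !inE xS xe; rewrite inE in eU.
rewrite mulnC -sum_nat_const; apply: leq_sum => x _.
exact: unaugmentable_uncolored cP cM (@degree_le_max G).
Qed.

Lemma resistance_le_vresistance (G : mgraph) :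
  resistance G <= (max_degree G %/ 2) * vresistance G.
Proof.
apply: leq_trans (resistance_le_vresistance' G) _.
by rewrite leq_mul2l vresistance'_le_vresistance orbT.
Qed.

Lemma qratio_le m n d : 0 < n -> m <= d * n -> (qratio m n <= d%:R)%R.
Proof.
move=> n0 mdn; rewrite /qratio Num.Theory.ler_pdivrMr ?Num.Theory.ltr0n //.
by rewrite -GRing.Theory.natrM Num.Theory.ler_nat.
Qed.

(** * The extremal multigraph *)

Section FatTriangle.

Variable D : nat.
Hypothesis D2 : 2 <= D.

Let t := D %/ 2.
Let v0 : 'I_3 := @Ordinal 3 0 isT.
Let v1 : 'I_3 := @Ordinal 3 1 isT.
Let v2 : 'I_3 := @Ordinal 3 2 isT.

(* Edge multiplicities are [t] on [01] and [02], and [D - t] on [12]. *)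
Definition fat_triangle_ends (e : 'I_D + 'I_t) : {set 'I_3} :=
  match e with
  | inl i => if i < t then [set v0; v1] else [set v1; v2]
  | inr _ => [set v0; v2]
  end.

Lemma card_fat_triangle_ends e : #|fat_triangle_ends e| = 2.
Proof. by case: e => [i|j] /=; [case: ifP|]; rewrite cards2. Qed.

Definition fat_triangle : mgraph := MGraph card_fat_triangle_ends.

Lemma ord3_cases (x : 'I_3) : [\/ x = v0, x = v1 | x = v2].
Proof.
case: x => -[|[|[|//]]] h; [apply: Or31|apply: Or32|apply: Or33]; exact: val_inj.
Qed.

Lemma fat_triangle_ends_meet (e f : edge fat_triangle) :
  ~~ [disjoint ends e & ends f].
Proof.
by apply/pred0Pn; case: e f => [i|i] [j|j] /=; do ?case: ifP => _;
  first [by exists v0; rewrite /= !inE | by exists v1; rewrite /= !inE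
       | by exists v2; rewrite /= !inE].
Qed.

Lemma card_ord_lt : #|[set i : 'I_D | i < t]| = t.
Proof.
have tD : t <= D by rewrite /t leq_div.
rewrite -sum1dep_card -(big_ord_widen D (fun _ => 1) tD) sum1_card card_ord //.
Qed.

Lemma degree_fat_triangle (x : 'I_3) :
  @degree fat_triangle x =
    #|[set i : 'I_D | x \in fat_triangle_ends (inl i)]| + (x != v1) * t.
Proof.
rewrite /degree -!sum1dep_card big_sumType /=; congr addn.
case: (ord3_cases x) => ->; rewrite ?mul1n ?mul0n.
- by rewrite -[RHS]card_ord -sum1_card; apply: eq_bigl => j; rewrite !inE.
- by rewrite big1 // => j; rewrite !inE.
- by rewrite -[RHS]card_ord -sum1_card; apply: eq_bigl => j; rewrite !inE.
Qed.

(** The degrees at [v0], [v1], [v2] are [2t], [D] and [D], and [2t <= D]. *)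
Lemma max_degree_fat_triangle : max_degree fat_triangle = D.
Proof.
have cC := cardsC [set i : 'I_D | i < t].
rewrite card_ord card_ord_lt in cC.
have d1 : @degree fat_triangle v1 = D.
  rewrite degree_fat_triangle eqxx addn0 -[RHS]card_ord -cardsT.
  congr #|pred_of_set _|; apply/setP=> i; rewrite !inE /=.
  by case: ifP; rewrite !inE.
apply/anti_leq/andP; split; last by rewrite -[X in X <= _]d1 degree_le_max.
apply/bigmax_leqP=> x _; case: (ord3_cases x) => ->; rewrite ?d1 //.
- rewrite degree_fat_triangle mul1n.
  have -> : [set i : 'I_D | v0 \in fat_triangle_ends (inl i)] = [set i : 'I_D | i < t].
    by apply/setP=> i; rewrite !inE /=; case: ifP; rewrite !inE.
  by rewrite card_ord_lt /t; lia.
- rewrite degree_fat_triangle mul1n.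
  have -> : [set i : 'I_D | v2 \in fat_triangle_ends (inl i)] = ~: [set i : 'I_D | i < t].
    by apply/setP=> i; rewrite !inE /=; case: ifP; rewrite !inE.
  by rewrite addnC cC.
Qed.

Lemma fat_triangle_connected : connected fat_triangle.
Proof.
have t0 : 0 < t by rewrite /t; lia.
have D0 : 0 < D by lia.
split; first by rewrite card_ord.
have sym : symmetric (@adjacent fat_triangle).
  by move=> x y; apply: eq_existsb => e; rewrite setUC.
have a01 : @adjacent fat_triangle v0 v1.
  by apply/existsP; exists (inl (Ordinal D0)); rewrite /= t0.
have a02 : @adjacent fat_triangle v0 v2.
  by apply/existsP; exists (inr (Ordinal t0)).
have from0 x : connect (@adjacent fat_triangle) v0 x.
  by case: (ord3_cases x) => ->; [exact: connect0|exact: connect1|exact: connect1].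
move=> x y; apply: connect_trans (from0 y).
by rewrite (sym_connect_sym sym).
Qed.

Lemma fat_triangle_resistance_ge : t <= resistance fat_triangle.
Proof.
rewrite /resistance; case: ex_minnP => n /existsP[F /andP[/eqP <-]] + _.
rewrite max_degree_fat_triangle => colF.
have /(_ setT) := edge_colorable_intersecting _ colF.
rewrite cardsT => /(_ (fun e f _ _ => fat_triangle_ends_meet (val e) (val f))).
rewrite card_sig; have := cardsC F.
have -> : #|edge fat_triangle| = D + t by rewrite card_sum !card_ord.
have -> : #|~: F| = #|[pred e | e \notin F]| by apply: eq_card => e; rewrite inE.
lia.
Qed.

Lemma fat_triangle_vresistance_le : vresistance fat_triangle <= 1.
Proof.
have <- : #|[set v0]| = 1 by rewrite cards1.
apply: (@vresistance_le fat_triangle [set v0]).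
have v1S : v1 \notin [set v0] by rewrite inE.
(* The surviving edges all join [v1] and [v2]. *)
apply: (@common_end_class1 (@del_vertices fat_triangle [set v0]) (Sub v1 v1S)) => -[e /= eS].
rewrite inE /=; case: e eS => [i|j] /=.
  by case: ifP => _ _; rewrite !inE.
by rewrite disjoint_sym disjoints1 !inE.
Qed.

End FatTriangle.

Theorem theorem3p2 :
  (forall G : mgraph, connected G ->
     [/\ resistance G <= (max_degree G %/ 2) * vresistance G,
         resistance G <= (max_degree G %/ 2) * vresistance' G,
         0 < vresistance G ->
           (qratio (resistance G) (vresistance G)
              <= (max_degree G %/ 2)%:R)%R
       & 0 < vresistance' G ->
           (qratio (resistance G) (vresistance' G)
              <= (max_degree G %/ 2)%:R)%R])
  /\
  (forall D : nat, 2 <= D ->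
     exists G : mgraph,
       [/\ connected G, max_degree G = D,
           0 < vresistance G /\ 0 < vresistance' G,
           (qratio (resistance G) (vresistance G) = (D %/ 2)%:R)%R
         & (qratio (resistance G) (vresistance' G) = (D %/ 2)%:R)%R]).
Proof.
split=> [G _|D D2].
  have rv := resistance_le_vresistance G; have rv' := resistance_le_vresistance' G.
  by split=> // pos; apply: qratio_le.
exists (fat_triangle D); set G := fat_triangle D.
have rv : resistance G <= D %/ 2 * vresistance' G.
  by rewrite -{1}(max_degree_fat_triangle D2) resistance_le_vresistance'.
have r_ge : D %/ 2 <= resistance G := fat_triangle_resistance_ge D2.
have v1 : vresistance G <= 1 := fat_triangle_vresistance_le D.
have v'v : vresistance' G <= vresistance G := vresistance'_le_vresistance G.
(* Otherwise [rv] would make the resistance 0, against [r_ge] and [D %/ 2 >= 1]. With [v1] and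
   [v'v], both vertex parameters are then 1. *)
have v'0 : 0 < vresistance' G by nia.
have -> : vresistance G = 1 by lia.
have v'1 : vresistance' G = 1 by lia.
have rE : resistance G = D %/ 2 by rewrite v'1 in rv; lia.
rewrite v'1 rE /qratio GRing.Theory.divr1; split=> //.
  exact: fat_triangle_connected.
exact: max_degree_fat_triangle.
Qed.
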